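(* Let $G=(V,E)$ be a cactus such that (a) the circumference of $G$ is at least 5, or (b) $G$ has a limb that is not isomorphic to any of $P_1,P_2,P_3,P_4,P_5,P_6,T7,T12$. Then $G$ is the edge intersection hypergraph of some 3-uniform hypergraph.
   Context: All graphs and hypergraphs are finite, may have isolated vertices, and have no loops or multiple edges. A hypergraph is 3-uniform if every hyperedge has exactly 3 vertices. The edge intersection hypergraph of $\mathcal{H}=(V,\mathcal{E})$ is $EI(\mathcal{H})=(V,\mathcal{E}^{EI})$ with $\mathcal{E}^{EI}=\{e_1\cap e_2 : e_1,e_2\in\mathcal{E},\ e_1\neq e_2,\ |e_1\cap e_2|\ge 2\}$; it has the same vertex set as $\mathcal{H}$, and when it is 2-uniform it is regarded as a simple graph; ''$G=EI(\mathcal{H})$'' means equality of vertex sets and edge sets. A cactus is a simple connected graph in which every edge lies on at most one cycle. The circumference of a graph is the length of a longest cycle in it. Limbs: from the cactus $G$ delete every edge that lies on a cycle of $G$ and every vertex of degree 2 (in $G$) that lies on a cycle of $G$; the result is a forest, and its connected components (trees, possibly single vertices) are the limbs of $G$. $P_n$ denotes the path with $n$ vertices. $T7$ is the tree with vertices $v_1,\ldots,v_5$ and edges $\{v_1,v_2\},\{v_2,v_3\},\{v_3,v_4\},\{v_3,v_5\}$; $T12$ is the tree with vertices $v_1,\ldots,v_6$ and edges $\{v_1,v_2\},\{v_2,v_3\},\{v_3,v_4\},\{v_2,v_5\},\{v_5,v_6\}$. *)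

(* Defs.v *)
From mathcomp Require Import all_boot.

Set Implicit Arguments.
Unset Strict Implicit.
Unset Printing Implicit Defensive.

(* A (hyper)graph on the finite vertex set T is given by its set of edges
   E : {set {set T}}; the vertex set is all of T, so isolated vertices are
   allowed and equality of hypergraphs on T is equality of edge sets.        *)

Section Hypergraphs.
Variable T : finType.
Implicit Types (E H : {set {set T}}) (C : {set {set T}}) (W : {set T}).

Definition uniform (k : nat) E : Prop := forall f, f \in E -> #|f| = k.

Definition EI H : {set {set T}} :=
  [set e1 :&: e2 | e1 in H, e2 in H & (e1 != e2) && (2 <= #|e1 :&: e2|)].

(* [set x; x] is a singleton, so adj E is irreflexive when E is 2-uniform.   *)
Definition adj E : rel T := [rel x y | [set x; y] \in E].

Definition degree E (v : T) : nat := #|[set f in E | v \in f]|.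

Definition connected E : Prop := forall x y : T, connect (adj E) x y.

Definition cycle_edges (c : seq T) : {set {set T}} :=
  [set [set x; next c x] | x in c].

(* Cycles are subgraphs, represented by their edge sets, so the different
   cyclic traversals of a cycle are identified. The bound on the length of
   the traversal c is harmless, see cyclesP.                                 *)
Definition cycles E : {set {set {set T}}} :=
  [set C | [exists n : 'I_#|T|.+1, exists c : n.-tuple T,
     [&& 2 < n, ucycleb (adj E) c & C == cycle_edges c]]].

Lemma cyclesP E C :
  reflect (exists c : seq T,
             [/\ 2 < size c, ucycle (adj E) c & C = cycle_edges c])
          (C \in cycles E).
Proof.
rewrite inE; apply: (iffP existsP) => [[n /existsP[c /and3P[n2 cE /eqP ->]]]|].
  by exists c; rewrite size_tuple.
case=> c [c2 cE ->].
have cT : size c < #|T|.+1.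
  by rewrite ltnS -(card_uniqP _) ?max_card //; case/andP: cE.
exists (Ordinal cT); apply/existsP; exists (in_tuple c).
by apply/and3P; split.
Qed.

Definition cactus E : Prop :=
  [/\ uniform 2 E, connected E &
      forall f, f \in E -> #|[set C in cycles E | f \in C]| <= 1].

(* Equal to 0 when E has no cycle. *)
Definition circumference E : nat := \max_(C in cycles E) #|C|.

(* cover (cycles E) is the set of the edges lying on a cycle, and its own
   cover is the set of the vertices lying on a cycle.                        *)
Definition limb_vertices E : {set T} :=
  [set v | ~~ ((degree E v == 2) && (v \in cover (cover (cycles E))))].

Definition limb_forest E : {set {set T}} :=
  [set f in E | (f \notin cover (cycles E)) && (f \subset limb_vertices E)].

(* A limb is represented by its vertex set W; its edges are limb_edges E W. *)
Definition limbs E : {set {set T}} :=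
  [set [set y | connect (adj (limb_forest E)) x y] | x in limb_vertices E].

Definition limb_edges E W : {set {set T}} :=
  [set f in limb_forest E | f \subset W].

(* The graph with vertex set W and edge set F is isomorphic to the graph with
   vertex set all of U and edge set K.                                       *)
Definition isomorphic (U : finType) W (F : {set {set T}})
    (K : {set {set U}}) : Prop :=
  exists h : U -> T,
    [/\ injective h, h @: [set: U] = W &
        [set h @: (f : {set U}) | f in K] = F].

End Hypergraphs.

(* The graph with vertices 0, ..., n-1 and edges {i, j} for (i, j) in s. *)
Definition graph_of (n : nat) (s : seq (nat * nat)) : {set {set 'I_n}} :=
  [set [set i; j] | i in 'I_n, j in 'I_n & (val i, val j) \in s].

Definition P_ (n : nat) : {set {set 'I_n}} :=
  graph_of n [seq (i, i.+1) | i <- iota 0 n.-1].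

(* The vertex v_i is i - 1. *)
Definition T7 : {set {set 'I_5}} :=
  graph_of 5 [:: (0, 1); (1, 2); (2, 3); (2, 4)].

Definition T12 : {set {set 'I_6}} :=
  graph_of 6 [:: (0, 1); (1, 2); (2, 3); (1, 4); (4, 5)].

(* Main.v *)
Require Import Defs.
From mathcomp Require Import all_boot.
From mathcomp Require Import zify.

(** Grow a set S of vertices and a list H of triples such that the pairs of
    vertices lying in at least two triples of H are the edges of the subgraph
    of the cactus induced on S, one bridge or one cycle at a time.

    A pendant edge uv is realised by the triples uvw, uvz, where each of w and z
    is a neighbour of u or a vertex sharing no triple with u. So a vertex u that
    may still receive a bridge needs two neighbours, or a neighbour and a
    reserved vertex r u sharing no triple with it; the condition r (r u) <> u
    ensures that using the reservation of u does not destroy that of another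
    vertex. A cycle through u needs no reservation: cycles of length at least 5
    are realised by their triples of consecutive vertices, triangles and
    4-cycles by explicit triples using a neighbour of u and other vertices of S.

    The starting point is a cycle of length at least 5, or a subtree of the
    limb: a limb outside the list of exceptions is one of four trees, no vertex
    of which will receive a bridge, or contains one of nine trees that carry
    reservations at all leaves. *)

Set Implicit Arguments.
Unset Strict Implicit.
Unset Printing Implicit Defensive.

(** * Codegrees in lists of triples *)

Definition codeg (T : eqType) (H : seq (seq T)) (x y : T) : nat :=
  count (fun t => (x \in t) && (y \in t)) H.

Definition heavy (T : eqType) (H : seq (seq T)) : rel T :=
  fun x y => (x != y) && (1 < codeg H x y).

Definition symp (T : eqType) (A : seq (T * T)) : rel T :=
  fun x y => ((x, y) \in A) || ((y, x) \in A).

(** Triples are lists, so that finite checks compute. They stand for sets, hence distinctness is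
    taken up to permutation. *)
Definition triple_system (T : eqType) (H : seq (seq T)) : bool :=
  all (fun t => uniq t && (size t == 3)) H
  && pairwise (fun t t' => ~~ perm_eq t t') H.

Section Codegree.
Variable T : eqType.
Implicit Types (H : seq (seq T)) (x y : T).

Lemma codegC H x y : codeg H x y = codeg H y x.
Proof. by apply: eq_count => t; rewrite andbC. Qed.

Lemma codeg_cat H1 H2 x y : codeg (H1 ++ H2) x y = codeg H1 x y + codeg H2 x y.
Proof. by rewrite /codeg count_cat. Qed.

Lemma codeg_gt0 H x y :
  0 < codeg H x y -> exists t, [/\ t \in H, x \in t & y \in t].
Proof. by rewrite -has_count => /hasP[t tH /andP[xt yt]]; exists t. Qed.

Lemma heavy_sym H : symmetric (heavy H).
Proof. by move=> x y; rewrite /heavy eq_sym codegC. Qed.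

Lemma symp_sym (A : seq (T * T)) : symmetric (symp A).
Proof. by move=> x y; rewrite /symp orbC. Qed.

End Codegree.

Lemma count_gt1P (I : eqType) (a : pred I) (r : seq I) : uniq r ->
  reflect (exists i j, [/\ i \in r, j \in r, i != j, a i & a j]) (1 < count a r).
Proof.
move=> ur; rewrite -size_filter; apply: (iffP idP) => [|[i [j [ir jr ij ai aj]]]].
  have := filter_uniq a ur; have := mem_filter a ^~ r.
  case: (filter a r) => [|i [|j f]] // memf uf _.
  have /andP[ai ir] : a i && (i \in r) by rewrite -memf mem_head.
  have /andP[aj jr] : a j && (j \in r) by rewrite -memf !inE eqxx orbT.
  by exists i, j; split=> //; case/andP: uf; rewrite inE negb_or => /andP[].
apply: (@uniq_leq_size _ [:: i; j]); first by rewrite /= inE ij.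
by move=> k; rewrite !inE => /orP[]/eqP->; rewrite mem_filter ?ai ?aj.
Qed.

(** * Gadgets on numbers and their placement on vertices *)

Section Relabel.
Variables (T : eqType) (x0 : T) (s : seq T).
Hypothesis us : uniq s.
Implicit Types (B : seq (seq nat)) (A : seq (nat * nat)).

Definition relabel B : seq (seq T) := map (map (nth x0 s)) B.

Definition relabel_pairs A : seq (T * T) :=
  [seq (nth x0 s p.1, nth x0 s p.2) | p <- A].

(** A vertex outside [s] has index [size s]; the bound on [t] keeps this value out of [t]. *)
Lemma mem_relabel t x : all (gtn (size s)) t ->
  (x \in map (nth x0 s) t) = (index x s \in t).
Proof.
move=> /allP st; apply/mapP/idP => [[i it ->]|it].
  by rewrite index_uniq //; apply: st.
by exists (index x s) => //; rewrite nth_index // -index_mem; apply: st.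
Qed.

Lemma codeg_relabel B x y : all (all (gtn (size s))) B ->
  codeg (relabel B) x y = codeg B (index x s) (index y s).
Proof.
move=> /allP sB; rewrite /codeg count_map; apply: eq_in_count => t /sB st.
by rewrite /= !mem_relabel.
Qed.

Lemma mem_relabel_pairs A x y :
    all (fun p => (p.1 < size s) && (p.2 < size s)) A ->
  ((x, y) \in relabel_pairs A) = ((index x s, index y s) \in A).
Proof.
move=> /allP sA; apply/mapP/idP => [[[i j] ijA [-> ->]]|ijA].
  by have /andP[/= si sj] := sA _ ijA; rewrite !index_uniq.
have /andP[/= si sj] := sA _ ijA.
by exists (index x s, index y s) => //=; rewrite !nth_index // -index_mem.
Qed.

Lemma symp_relabel A x y :
    all (fun p => (p.1 < size s) && (p.2 < size s)) A ->
  symp (relabel_pairs A) x y = symp A (index x s) (index y s).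
Proof. by move=> sA; rewrite /symp !mem_relabel_pairs. Qed.

Lemma relabel_cycle c :
  relabel_pairs (zip c (rot 1 c)) =
  zip (map (nth x0 s) c) (rot 1 (map (nth x0 s) c)).
Proof.
rewrite -map_rot; elim: c (rot 1 c) => [|i c IH] [|j c'] //=.
by rewrite -IH.
Qed.

Lemma map_index_relabel t : all (gtn (size s)) t ->
  map (index^~ s) (map (nth x0 s) t) = t.
Proof.
move=> /allP st; rewrite -map_comp -[RHS]map_id; apply/eq_in_map => i /st /= si.
by rewrite index_uniq.
Qed.

Lemma triple_system_relabel B : all (all (gtn (size s))) B ->
  triple_system B -> triple_system (relabel B).
Proof.
move=> /allP sB /andP[/allP B3 pB]; apply/andP; split.
  apply/allP => _ /mapP[t tB ->]; have /andP[ut st] := B3 _ tB.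
  rewrite size_map st andbT map_inj_in_uniq // => i j it jt.
  have /allP ss := sB _ tB.
  move=> /(congr1 (index^~ s)); rewrite !index_uniq //; exact: ss.
rewrite pairwise_map; apply: (@sub_in_pairwise _ (mem B)) pB; last exact: allss.
move=> t t' tB t'B /=; apply: contra => /(perm_map (index^~ s)).
by rewrite !map_index_relabel ?sB.
Qed.

End Relabel.

(* B is a list of triples on the vertices 0, ..., n - 1, to be glued to an
   existing hypergraph along the vertices 0, ..., m - 1; A lists the edges that
   are created. What B does to the old pairs is left to the user. *)
Record gadget (n m : nat) (B : seq (seq nat)) (A : seq (nat * nat)) : Prop :=
  Gadget {
    gadget_lt : all (all (gtn n)) B;
    gadget_triple : triple_system B;
    gadget_new : all (has (leq m)) B;
    gadget_heavy : forall i j, i < n -> j < n -> i != j ->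
      (m <= i) || (m <= j) -> (1 < codeg B i j) = symp A i j;
    gadget_edge : all (fun p => [&& p.1 < n, p.2 < n, p.1 != p.2 &
      (m <= p.1) || (m <= p.2)]) A }.

(** This decidable form lets each explicit gadget be checked by computation. The long cycles form an
    infinite family, for which [gadget] is proved directly. *)
Definition gadgetb n m B A : bool :=
  [&& all (all (gtn n)) B, triple_system B, all (has (leq m)) B,
    all (fun i => all (fun j => (i != j) ==> ((m <= i) || (m <= j)) ==>
      ((1 < codeg B i j) == symp A i j)) (iota 0 n)) (iota 0 n) &
    all (fun p => [&& p.1 < n, p.2 < n, p.1 != p.2 &
      (m <= p.1) || (m <= p.2)]) A].

Lemma gadgetP n m B A : gadgetb n m B A -> gadget n m B A.
Proof.
case/and5P=> ? ? ? /allP cB ?; split=> // i j ilt jlt ij mij.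
have := cB i; rewrite mem_iota ilt => /(_ isT) /allP /(_ j).
by rewrite mem_iota jlt ij mij => /(_ isT) /eqP.
Qed.

(** * Gluing a gadget to a list of triples *)

Section Glue.
Variables (T : finType) (x0 : T) (S : {set T}) (H : seq (seq T)).
Variables (s : seq T) (m : nat) (B : seq (seq nat)) (A : seq (nat * nat)).
Hypotheses (us : uniq s) (gB : gadget (size s) m B A).
Hypothesis HS : forall t x, t \in H -> x \in t -> x \in S.
Hypothesis sS : forall i, i < size s -> (nth x0 s i \in S) = (i < m).
Hypothesis old : forall i j, i < m -> j < m -> i != j -> 0 < codeg B i j ->
  heavy H (nth x0 s i) (nth x0 s j)
  \/ codeg H (nth x0 s i) (nth x0 s j) = 0 /\ codeg B i j = 1.

Let H' := relabel x0 s B ++ H.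

Lemma codeg_glue x y :
  codeg H' x y = codeg B (index x s) (index y s) + codeg H x y.
Proof. by rewrite codeg_cat codeg_relabel //; case: gB. Qed.

Lemma codeg_gadget_lt i j : 0 < codeg B i j -> (i < size s) && (j < size s).
Proof.
case/codeg_gt0=> t [tB it jt]; case: gB => /allP /(_ _ tB) /allP tlt _ _ _ _.
by have /= -> := tlt _ it; have /= -> := tlt _ jt.
Qed.

Lemma codeg_support x y : 0 < codeg H x y -> (x \in S) && (y \in S).
Proof. by case/codeg_gt0=> t [tH xt yt]; rewrite (HS tH xt) (HS tH yt). Qed.

(** A pair with a new vertex is in no triple of [H], so the gadget alone decides it. By [old], an
    old pair met by the gadget either was heavy and stays so, or rises from codegree 0 to 1, which
    is still light. *)
Lemma heavy_glue x y :
  heavy H' x y = heavy H x y || symp A (index x s) (index y s).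
Proof.
rewrite /heavy codeg_glue.
have sA i j : symp A i j -> [&& i < size s, j < size s, i != j &
    (m <= i) || (m <= j)].
  case: gB => _ _ _ _ /allP cA; case/orP=> /cA /and4P[/= -> -> ij mij].
    by rewrite ij mij.
  by rewrite eq_sym ij orbC mij.
case: (eqVneq x y) => [->|xy] /=.
  by case: (boolP (symp A _ _)) => // /sA; rewrite eqxx !andbF.
have [cB0|cB] := posnP (codeg B (index x s) (index y s)).
  rewrite cB0 add0n; case: (boolP (symp A _ _)) => [Axy|_]; last by rewrite orbF.
  have /and4P[xs ys ij mij] := sA _ _ Axy.
  by move: Axy; case: gB => _ _ _ <- // _; rewrite cB0.
have /andP[xs ys] := codeg_gadget_lt cB.
have ij : index x s != index y s.
  apply: contra xy => /eqP eij.
  by rewrite -(nth_index x0 (s := s) (x := x)) -?index_mem // eij nth_index // -index_mem.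
case: (boolP ((m <= index x s) || (m <= index y s))) => mij.
  have -> : codeg H x y = 0.
    apply/eqP; rewrite -leqn0 leqNgt; apply/negP => /codeg_support /andP[].
    rewrite -{1}(nth_index x0 (s := s) (x := x)) -?index_mem // sS //.
    rewrite -{1}(nth_index x0 (s := s) (x := y)) -?index_mem // sS //.
    by move: mij; rewrite ![m <= _]leqNgt; case: (_ < m); case: (_ < m).
  by rewrite addn0 /=; case: gB => _ _ _ ->.
have -> : symp A (index x s) (index y s) = false.
  by apply/negP => /sA /and4P[_ _ _]; rewrite (negPf mij).
move: mij; rewrite negb_or -!ltnNge => /andP[xm ym].
have := old xm ym ij cB; rewrite !nth_index -?index_mem // orbF.
by case=> [/andP[_ c2]|[-> ->]] //; rewrite c2 ltn_addl.
Qed.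

(** Each triple of the gadget has a new vertex, so no triple of [H] is a permutation of it. *)
Lemma triple_system_glue : triple_system H -> triple_system H'.
Proof.
case: gB => Blt Btr /allP Bnew _ _ trH.
have /andP[a1 a2] := triple_system_relabel x0 us Blt Btr.
case/andP: trH => h1 h2; rewrite /triple_system all_cat a1 h1 pairwise_cat a2 h2.
rewrite /= !andbT; apply/allrelP => _ t' /mapP[t tB ->] t'H.
apply/negP => /perm_mem E; have /hasP[i it mi] := Bnew _ tB.
have ilt : i < size s by move/allP: Blt => /(_ _ tB) /allP /(_ _ it).
have : nth x0 s i \in t' by rewrite -E map_f.
by move/(HS t'H); rewrite sS // ltnNge mi.
Qed.

Lemma glue_support t x :
  t \in H' -> x \in t -> x \in S :|: [set y in s].
Proof.
rewrite mem_cat !inE => /orP[/mapP[t' t'B ->]|tH xt]; last by rewrite (HS tH xt).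
case: gB => /allP /(_ _ t'B) lt _ _ _ _.
by rewrite mem_relabel // => /(allP lt) /=; rewrite index_mem => ->; rewrite orbT.
Qed.

End Glue.

(** * Cycles and bridges of a cactus *)

Section Cactus.
Variables (T : finType) (E : {set {set T}}).
Hypothesis cactusE : cactus E.
Implicit Types (x y z u v : T) (c p q : seq T) (S : {set T}) (F : rel T).

Lemma set2_eq x y u v :
  ([set x; y] == [set u; v]) = (x == u) && (y == v) || (x == v) && (y == u).
Proof.
apply/eqP/idP => [e|/orP[]/andP[/eqP-> /eqP->] //]; last exact: setUC.
have := set21 x y; have := set22 x y; rewrite e !inE.
have := set21 u v; have := set22 u v; rewrite -e !inE.
rewrite ![u == _]eq_sym ![v == _]eq_sym.
by case: (x == u); case: (x == v); case: (y == u); case: (y == v).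
Qed.

Lemma adj_sym : symmetric (adj E).
Proof. by move=> x y; rewrite /adj /= setUC. Qed.

Lemma adj_neq x y : adj E x y -> x != y.
Proof.
case: cactusE => E2 _ _ /E2; rewrite cards2.
by case: (x != y).
Qed.

Lemma zip_next c : uniq c -> zip c (rot 1 c) = [seq (x, next c x) | x <- c].
Proof.
case: c => // x p up; rewrite rot1_cons.
apply: (@eq_from_nth _ (x, x)); first by rewrite size_zip size_map size_rcons minnn.
move=> i; rewrite size_zip size_rcons minnn => ip.
rewrite nth_zip ?size_rcons // (nth_map x) // next_nth mem_nth // index_uniq //.
congr pair; rewrite nth_rcons; have := ip; rewrite ltnS leq_eqVlt.
by case/orP=> [/eqP->|->] //; rewrite nth_default // ltnn eqxx.
Qed.

Lemma mem_cycle_edges c x y : uniq c ->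
  ([set x; y] \in cycle_edges c) = symp (zip c (rot 1 c)) x y.
Proof.
move=> uc; rewrite /symp zip_next //; apply/imsetP/orP.
  case=> z zc /eqP; rewrite set2_eq => /orP[]/andP[/eqP-> /eqP->].
    by left; apply: map_f.
  by right; apply: map_f.
case=> /mapP[z zc [-> ->]]; exists z => //; exact: setUC.
Qed.

Lemma cycles_sub C : C \in cycles E -> C \subset E.
Proof.
case/cyclesP=> c [_ cE ->]; apply/subsetP => _ /imsetP[x xc ->].
exact: next_cycle (ucycle_cycle cE) xc.
Qed.

Lemma cycles_unique C1 C2 f :
  C1 \in cycles E -> C2 \in cycles E -> f \in C1 -> f \in C2 -> C1 = C2.
Proof.
move=> C1E C2E f1 f2; case: cactusE => _ _ /(_ f).
move=> /(_ (subsetP (cycles_sub C1E) _ f1)) /card_le1_eqP; apply.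
  exact/setIdP.
exact/setIdP.
Qed.

Lemma cycle_edges_cycles c : 2 < size c -> ucycle (adj E) c ->
  cycle_edges c \in cycles E.
Proof. by move=> c2 cE; apply/cyclesP; exists c. Qed.

Definition bridge x y := adj E x y && ([set x; y] \notin cover (cycles E)).

Lemma bridge_sym : symmetric bridge.
Proof. by move=> x y; rewrite /bridge adj_sym setUC. Qed.

Lemma bridge_adj x y : bridge x y -> adj E x y.
Proof. by case/andP. Qed.

Lemma bridge_cycles C x y : C \in cycles E -> [set x; y] \in C -> ~~ bridge x y.
Proof.
move=> CE xyC; rewrite negb_and negbK; apply/orP; right.
by apply/bigcupP; exists C.
Qed.

Lemma nonbridge_cycle u v : adj E u v -> ~~ bridge u v ->
  exists c, ucycle (adj E) [:: u, v & c] /\ 0 < size c.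
Proof.
move=> uv; rewrite /bridge uv negbK => /bigcupP[C /cyclesP[c [c2 cE ->]]].
have main d : 2 < size d -> ucycle (adj E) d -> u \in d -> v = next d u ->
    exists c, ucycle (adj E) [:: u, v & c] /\ 0 < size c.
  move=> d2 dE ud; have [i d' rd] := rot_to ud.
  rewrite -(next_rot i (ucycle_uniq dE)) rd.
  have : 2 < size (rot i d) by rewrite size_rot.
  rewrite rd; case: d' rd => [|v' d'] //= rd ds; rewrite eqxx => ->.
  by exists d'; rewrite -rd rot_ucycle.
case/imsetP=> z zc /eqP; rewrite set2_eq => /orP[]/andP[/eqP eu /eqP ev].
  by apply: (main c) => //; rewrite ?ev eu.
(* Here [c] runs from [v] to [u], so it is traversed backwards. *)
apply: (main (rev c)).
- by rewrite size_rev.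
- have /andP[cc uc] := cE; apply/andP; rewrite rev_uniq; split=> //.
  by rewrite rev_cycle (eq_cycle (e' := adj E)) // => a b; rewrite adj_sym.
- by rewrite mem_rev eu mem_next.
- by rewrite next_rev ?(ucycle_uniq cE) // eu ev prev_next // (ucycle_uniq cE).
Qed.

(** A subgraph [F] of the cactus with this property is a union of blocks: bridges and whole
    cycles. *)
Definition cycle_closed F : Prop := forall C x y z t, C \in cycles E ->
  [set x; y] \in C -> F x y -> [set z; t] \in C -> F z t.

(** * Ears of a connected union of blocks *)

Section Ear.
Variables (S : {set T}) (F : rel T).
Hypotheses (symF : symmetric F) (FS : forall x y, F x y -> y \in S)
  (FE : subrel F (adj E)).
Hypothesis conF : forall x y, x \in S -> y \in S -> connect F x y.
Hypothesis cycF : cycle_closed F.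

(** An [F]-path from [y] back to [x] closes the ear into a cycle of the graph. This cycle has an
    edge in [F], so all its edges are in [F]; then the first inner vertex of the ear would lie in
    [S]. *)
Lemma ear x q y : x \in S -> y \in S -> x != y -> path (adj E) x (rcons q y) ->
  uniq q -> (forall z, z \in q -> z \notin S) -> q = [::] /\ F x y.
Proof.
move=> xS yS xy pq uq qS; have [r Fr] := connectP (conF yS xS).
case: (shortenP Fr) => p Fp up _ ex; have {Fr} : path F y p by [].
case: (lastP p) Fp up ex => [|p' x'] Fp up; first by move=> e; rewrite e eqxx in xy.
rewrite last_rcons => ex; rewrite -{x'}ex in Fp up * => _.
have pS z : z \in y :: rcons p' x -> z \in S.
  rewrite inE => /orP[/eqP-> //|].
  elim: (rcons p' x) (y) Fp => //= a r' IH b /andP[/FS aS Fr'].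
  by rewrite inE => /orP[/eqP->|/(IH a Fr')].
have cE : path (adj E) y (rcons p' x ++ rcons q y).
  by rewrite cat_path (sub_path FE Fp) last_rcons.
have uc : uniq (y :: p' ++ x :: q).
  have -> : y :: p' ++ x :: q = (y :: rcons p' x) ++ q by rewrite /= cat_rcons.
  rewrite cat_uniq up uq andbT /=; apply/hasPn => z zq.
  by apply: contra (qS z zq); apply: pS.
have uE : ucycle (adj E) (y :: p' ++ x :: q).
  by rewrite /ucycle /= rcons_cat /= -cat_rcons cE.
(* A closed walk with only two vertices is no cycle; then the ear and the [F]-path are the same
   edge. *)
have [c2|] := ltnP 2 (size (y :: p' ++ x :: q)); last first.
  rewrite /= size_cat /= addnS !ltnS leqn0 addn_eq0 !size_eq0.
  move=> /andP[/eqP p0 /eqP q0]; split=> //; rewrite symF.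
  by move: Fp; rewrite p0 /= andbT.
have Ec : zip (y :: p' ++ x :: q) (rot 1 (y :: p' ++ x :: q)) =
    zip (y :: p') (rcons p' x) ++ zip (x :: q) (rcons q y).
  rewrite rot1_cons rcons_cat rcons_cons -cat_rcons -cat_cons zip_cat //.
  by rewrite size_rcons.
have [w Fyw yw] : exists2 w, F y w & (y, w) \in zip (y :: p') (rcons p' x).
  by case: (p') Fp => [|w r'] /= /andP[Fyw _]; exists w || exists x; rewrite ?mem_head.
have Fx z : (x, z) \in zip (x :: q) (rcons q y) -> F x z.
  move=> xz; apply: cycF (cycle_edges_cycles c2 uE) _ Fyw _.
    by rewrite mem_cycle_edges // /symp Ec mem_cat yw.
  by rewrite mem_cycle_edges // /symp Ec mem_cat xz orbT.
case: q {pq uq cE uc uE c2 Ec} qS Fx => [|a q] qS Fx.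
  by split=> //; apply: Fx; rewrite mem_head.
by have /negP[] := qS a (mem_head _ _); apply/FS/Fx/mem_head.
Qed.

(** This is an ear without inner vertices; it makes [F] the subgraph induced on [S]. *)
Lemma ear_edge x y : x \in S -> y \in S -> adj E x y -> F x y.
Proof.
move=> xS yS xy; have [] // := @ear x [::] y xS yS (adj_neq xy).
by rewrite /= xy.
Qed.

(** Otherwise the cycle, followed from [u] through [v] up to its first return to [S], would be an
    ear with the inner vertex [v]. *)
Lemma ear_cycle u v c : u \in S -> v \notin S -> ucycle (adj E) [:: u, v & c] ->
  forall z, z \in v :: c -> z \notin S.
Proof.
move=> uS vS /andP[uE uc] z zc; apply/negP => zS.
have hS : has (mem S) (v :: c) by apply/hasP; exists z.
(* Phrased with [head], this fact survives the splitting of [v :: c] and rules out an empty [q1]. *)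
have hv : head u (v :: c) \notin S by [].
case: (split_find hS) uE uc hv => y q1 q2 yS; rewrite -all_predC => /allP q1S.
rewrite cons_uniq /= rcons_cat cat_path => /andP[pE _] /andP[].
rewrite mem_cat mem_rcons inE !negb_or => /andP[/andP[uy _] _].
rewrite cat_uniq rcons_uniq => /andP[/andP[_ uq1] _].
by have [-> _] := ear uS yS uy pE uq1 q1S; rewrite /= (yS : y \in S).
Qed.

End Ear.

(** * Invariants of the construction *)

Record core (S : {set T}) (H : seq (seq T)) : Prop := Core {
  core_triple : triple_system H;
  core_sub : forall t x, t \in H -> x \in t -> x \in S;
  core_adj : subrel (heavy H) (adj E);
  core_conn : forall x y, x \in S -> y \in S -> connect (heavy H) x y;
  core_cyc : cycle_closed (heavy H) }.

Lemma core_heavyS S H x y : core S H -> heavy H x y -> y \in S.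
Proof.
case=> _ HS _ _ _ /andP[_ c2].
by have [|t [tH _ yt]] := @codeg_gt0 _ H x y; [exact: ltnW | exact: HS tH yt].
Qed.

Lemma core0 : core set0 [::].
Proof.
by split=> // [x y|x y|C x y z t _ _]; rewrite ?inE // /heavy andbF.
Qed.

(** A further bridge at [u] needs two partners for its triples. The first case offers two
    neighbours, the second has no bridge left to add, and in the third [r u] joins the neighbour
    that [state_nbr] provides. *)
Definition ready (S : {set T}) (H : seq (seq T)) (r : T -> T) (u : T) : Prop :=
  [\/ exists w z, [/\ w != z, heavy H u w & heavy H u z],
      forall v, bridge u v -> heavy H u v
    | [/\ r u \in S, codeg H u (r u) = 0 & r (r u) != u]].

(** Four vertices suffice for all gadgets: a 4-cycle uses two old vertices besides [u] and a
    neighbour, and a new leaf reserves a vertex outside its own two triples. *)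
Record state (S : {set T}) (H : seq (seq T)) (r : T -> T) : Prop := State {
  state_core : core S H;
  state_card : 3 < #|S|;
  state_ready : forall u, u \in S -> ready S H r u }.

(** * Cores under gluing *)

Section CoreGlue.
Variables (x0 : T) (S : {set T}) (H : seq (seq T)).
Variables (s : seq T) (m : nat) (B : seq (seq nat)) (A : seq (nat * nat)).
Hypotheses (coreH : core S H) (us : uniq s) (gB : gadget (size s) m B A).
Hypothesis sS : forall i, i < size s -> (nth x0 s i \in S) = (i < m).
Hypothesis old : forall i j, i < m -> j < m -> i != j -> 0 < codeg B i j ->
  heavy H (nth x0 s i) (nth x0 s j)
  \/ codeg H (nth x0 s i) (nth x0 s j) = 0 /\ codeg B i j = 1.
Let H' := relabel x0 s B ++ H.
Let D := symp (relabel_pairs x0 s A).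

Lemma core_heavy_glue x y : heavy H' x y = heavy H x y || D x y.
Proof.
rewrite (heavy_glue us gB (core_sub coreH) sS old) /D symp_relabel //.
case: gB => _ _ _ _ /allP cA; apply/allP => p /cA /and4P[-> ->] //.
Qed.

Lemma core_glue u : subrel D (adj E) -> cycle_closed D -> u \in s ->
  (forall x, x \in S -> connect (heavy H') u x) ->
  (forall x, x \in s -> x \notin S -> connect (heavy H') u x) ->
  core (S :|: [set x in s]) H'.
Proof.
move=> DE cycD us' uS ucon; split.
- exact: triple_system_glue us gB (core_sub coreH) sS (core_triple coreH).
- exact: glue_support us gB (core_sub coreH).
- move=> x y; rewrite core_heavy_glue => /orP[|/DE //].
  exact: core_adj coreH _ _.
- have ux x : x \in S :|: [set x in s] -> connect (heavy H') u x.
    rewrite !inE; case: (boolP (x \in S)) => [/uS //|xS /= xs].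
    exact: ucon.
  move=> x y /ux cx /ux cy; apply: connect_trans cy.
  by rewrite (sym_connect_sym (heavy_sym H')).
- move=> C x y z t CE xyC; rewrite !core_heavy_glue => /orP[Fxy|Dxy] ztC.
    by rewrite (core_cyc coreH CE xyC Fxy ztC).
  by rewrite (cycD _ _ _ _ _ CE xyC Dxy ztC) orbT.
Qed.

End CoreGlue.

(** A cycle sharing an edge with [c] has the same edges as [c], by [cycles_unique]. *)
Lemma cycle_closed_cycle c : 2 < size c -> ucycle (adj E) c ->
  cycle_closed (symp (zip c (rot 1 c))).
Proof.
move=> c2 cE C x y z t CE xyC; rewrite -!mem_cycle_edges ?(ucycle_uniq cE) //.
by move=> xyc; rewrite (cycles_unique CE (cycle_edges_cycles c2 cE) xyC xyc).
Qed.

Lemma cycle_pairs_adj c : ucycle (adj E) c -> subrel (symp (zip c (rot 1 c))) (adj E).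
Proof.
move=> cE x y; rewrite -mem_cycle_edges ?(ucycle_uniq cE) //.
case/imsetP=> z zc; rewrite /adj /= => ->.
exact: next_cycle (ucycle_cycle cE) zc.
Qed.

Lemma cycle_pair_next c x : uniq c -> x \in c -> symp (zip c (rot 1 c)) x (next c x).
Proof. by move=> uc xc; rewrite -mem_cycle_edges //; apply/imsetP; exists x. Qed.

Lemma cycle_pairs_deg2 c x : uniq c -> 2 < size c -> x \in c ->
  exists y z, [/\ y != z, symp (zip c (rot 1 c)) x y & symp (zip c (rot 1 c)) x z].
Proof.
move=> uc c2 xc; exists (next c x), (prev c x); split.
(* If both neighbours of [x] coincided, two steps along [c] would return to [x], against a length of
   at least 3. *)
- apply/eqP => e; have : next c (next c x) = x by rewrite e next_prev.
  have [i c' rc] := rot_to xc; rewrite -!(next_rot i uc) rc.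
  have := uc; rewrite -(rot_uniq i) rc; have := c2; rewrite -(size_rot i) rc.
  case: c' {rc e} => [|a [|b c']] //= _; rewrite eqxx !inE !negb_or.
  case/andP=> /and3P[xa xb _] _; rewrite eq_sym (negPf xa) eqxx => bx.
  by rewrite bx eqxx in xb.
- exact: cycle_pair_next.
by rewrite symp_sym -{2}(next_prev uc x) cycle_pair_next // mem_prev.
Qed.

Lemma cycle_connect c u : uniq c -> u \in c -> forall x, x \in c ->
  connect (symp (zip c (rot 1 c))) u x.
Proof.
move=> uc uinc x xc; have [i c' rc] := rot_to uinc.
have cyc : cycle (symp (zip c (rot 1 c))) (rot i c).
  rewrite rot_cycle; apply: cycle_from_next => // y; exact: cycle_pair_next.
move: cyc; rewrite rc /= => /path_connect; apply.
by rewrite -(mem_rot i) rc in xc; rewrite -rcons_cons mem_rcons inE xc orbT.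
Qed.

(** * Gluing a cycle *)

Section CoreCycle.
Variables (x0 : T) (S : {set T}) (H : seq (seq T)).
Variables (s : seq T) (m : nat) (B : seq (seq nat)) (c0 : seq nat).
Let A := zip c0 (rot 1 c0).
Let c := map (nth x0 s) c0.
Hypotheses (coreH : core S H) (us : uniq s) (gB : gadget (size s) m B A).
Hypothesis sS : forall i, i < size s -> (nth x0 s i \in S) = (i < m).
Hypothesis old : forall i j, i < m -> j < m -> i != j -> 0 < codeg B i j ->
  heavy H (nth x0 s i) (nth x0 s j).
Hypothesis c0s : all (gtn (size s)) c0.
Hypotheses (c2 : 2 < size c) (cE : ucycle (adj E) c).
Let H' := relabel x0 s B ++ H.

Lemma heavy_cycle x y :
  heavy H' x y = heavy H x y || symp (zip c (rot 1 c)) x y.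
Proof.
rewrite (core_heavy_glue coreH us gB sS); last by move=> i j *; left; apply: old.
by rewrite relabel_cycle.
Qed.

(** An empty [S] is the case of the initial cycle, where a vertex of [c] serves as base point. *)
Lemma core_cycle : S = set0 \/ (exists2 u, u \in c & u \in S) ->
  (forall x, x \in s -> x \notin S -> x \in c) ->
  core (S :|: [set x in s]) H'.
Proof.
move=> uS sc.
have cs x : x \in c -> x \in s.
  by case/mapP=> i /(allP c0s) si ->; apply: mem_nth.
have mono1 : subrel (connect (heavy H)) (connect (heavy H')).
  by apply: connect_sub => x y Fxy; apply: connect1; rewrite heavy_cycle Fxy.
have mono2 : subrel (connect (symp (zip c (rot 1 c)))) (connect (heavy H')).
  by apply: connect_sub => x y Fxy; apply: connect1; rewrite heavy_cycle Fxy orbT.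
have uc := ucycle_uniq cE.
have ED : relabel_pairs x0 s A = zip c (rot 1 c).
  exact: relabel_cycle.
have [u uinc uS'] : exists2 u, u \in c & forall x, x \in S -> connect (heavy H) u x.
  case: uS => [->|[u uinc uS]]; last first.
    by exists u => // x; apply: (core_conn coreH).
  by exists (nth x0 c 0) => [|x]; rewrite ?inE // mem_nth // (ltn_trans _ c2).
apply: (core_glue coreH us gB sS _ _ _ (cs _ uinc)); rewrite ?ED.
- by move=> i j *; left; apply: old.
- exact: cycle_pairs_adj.
- exact: cycle_closed_cycle.
- by move=> x /uS' /mono1.
by move=> x xs xS; apply/mono2/cycle_connect => //; apply: sc.
Qed.

(** The hypothesis [old] of this section lets the gadget meet only heavy old pairs, so a reserved
    pair keeps codegree 0 and [r] stays the same. *)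
Lemma ready_cycle r u : u \in S -> ready S H r u -> ready (S :|: [set x in s]) H' r u.
Proof.
move=> uS; case=> [[w [z [wz uw uz]]]|clu|[ruS cu rru]].
- by apply: Or31; exists w, z; rewrite !heavy_cycle uw uz.
- by apply: Or32 => v /clu uv; rewrite heavy_cycle uv.
apply: Or33; split=> //; first by rewrite inE ruS.
rewrite (codeg_glue x0 H us gB) cu addn0; apply/eqP; rewrite -leqn0 leqNgt.
apply/negP => cB; have /andP[us' rus] := codeg_gadget_lt gB cB.
have im x : index x s < size s -> x \in S -> index x s < m.
  by move=> xs; rewrite -sS // nth_index // -index_mem.
have uru : index u s != index (r u) s.
  apply: contra rru => /eqP e.
  (* The condition on [r (r u)] also excludes [r u = u]. *)
  suff e' : r u = u by rewrite e' e'.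
  by have := congr1 (nth x0 s) e; rewrite !nth_index -?index_mem.
have := old (im _ us' uS) (im _ rus ruS) uru cB.
by rewrite !nth_index -?index_mem // /heavy cu andbF.
Qed.

(** A new vertex lies on the cycle and has two neighbours there, so it is ready without a
    reservation. *)
Lemma state_cycle r : S = set0 \/ (exists2 u, u \in c & u \in S) ->
  (forall x, x \in s -> x \notin S -> x \in c) ->
  (forall u, u \in S -> ready S H r u) -> 3 < #|S :|: [set x in s]| ->
  state (S :|: [set x in s]) H' r.
Proof.
move=> uS sc rS S3; split=> // [|x]; first exact: core_cycle.
have uc := ucycle_uniq cE; have [xc _|xc] := boolP (x \in c).
  have [y [z [yz xy xz]]] := cycle_pairs_deg2 uc c2 xc.
  by apply: Or31; exists y, z; rewrite !heavy_cycle xy xz !orbT.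
case: (boolP (x \in S)) => [xS _|xS]; first exact/ready_cycle/rS.
by rewrite !inE (negPf xS) => /= xs; rewrite (sc _ xs xS) in xc.
Qed.

End CoreCycle.

(** * Consecutive triples on a long cycle *)

Definition cycle_succ (k i : nat) : nat := if i.+1 == k then 0 else i.+1.

Definition cycle_triple (k i : nat) : seq nat :=
  [:: i; cycle_succ k i; cycle_succ k (cycle_succ k i)].

Definition cycle_triples (k : nat) : seq (seq nat) :=
  [seq cycle_triple k i | i <- iota 0 k].

Definition cycle_pairs (k : nat) : seq (nat * nat) :=
  [seq (i, cycle_succ k i) | i <- iota 0 k].

Lemma zip_rot1_iota k : zip (iota 0 k) (rot 1 (iota 0 k)) = cycle_pairs k.
Proof.
apply: (@eq_from_nth _ (0, 0)) => [|i].
  by rewrite size_zip size_map size_rot minnn.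
rewrite size_zip size_rot minnn size_iota => ik.
rewrite nth_zip ?size_rot // (nth_map 0) ?size_iota // nth_iota // add0n.
congr pair; rewrite /cycle_succ; case: k ik => // k ik.
rewrite [iota _ _]/= rot1_cons nth_rcons size_iota eqSS.
case: (ltngtP i k) => [ilt||_]; [by rewrite nth_iota | by lia | by []].
Qed.

Lemma cycle_succ_lt k i : i < k ->
  cycle_succ k i < k /\ (cycle_succ k i = i.+1 \/ cycle_succ k i + k = i.+1).
Proof. by rewrite /cycle_succ => ik; case: eqP; lia. Qed.

Lemma mem_cycle_triple k i l : i < k -> l \in cycle_triple k i <->
  l = i \/ l < k /\ (l = i.+1 \/ l = i.+2 \/ l + k = i.+1 \/ l + k = i.+2).
Proof.
move=> ik; have [h1 h2] := cycle_succ_lt ik; have [h3 h4] := cycle_succ_lt h1.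
by rewrite /cycle_triple !inE; split; lia.
Qed.

Lemma mem_cycle_pairs k i j : i < k ->
  (i, j) \in cycle_pairs k <-> j < k /\ (j = i.+1 \/ j + k = i.+1).
Proof.
move=> ik; split=> [/mapP[a]|h].
  rewrite mem_iota add0n => /andP[_ ak] [-> ->].
  by have [h1 h2] := cycle_succ_lt ak; lia.
apply/mapP; exists i; first by rewrite mem_iota; lia.
by congr pair; have [h1 h2] := cycle_succ_lt ik; lia.
Qed.

(** Vertices i and i+1 share the triples starting at i-1 and i. Vertices at distance 2 share one
    triple when [k] is at least 5; for [k = 4] they would share two. With [m] at most 1 there is no
    old pair to consider. *)
Lemma cycle_gadget k m : 4 < k -> m <= 1 ->
  gadget k m (cycle_triples k) (cycle_pairs k).
Proof.
move=> k5 m1; have all_iota (a : pred nat) : (forall i, i < k -> a i) -> all a (iota 0 k).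
  by move=> ha; apply/allP => i; rewrite mem_iota => /andP[_ /ha].
split.
- rewrite all_map; apply: all_iota => i ik.
  by apply/allP => l /(mem_cycle_triple _ ik) /=; lia.
- apply/andP; split.
    rewrite all_map; apply: all_iota => i ik /=; rewrite !inE.
    by have [h1 h2] := cycle_succ_lt ik; have [h3 h4] := cycle_succ_lt h1; lia.
  rewrite pairwise_map; have := iota_ltn_sorted 0 k.
  rewrite sorted_pairwise; last exact: ltn_trans.
  apply: (@sub_in_pairwise _ (mem (iota 0 k))); last exact: allss.
  move=> i j; rewrite !mem_iota !add0n => /andP[_ ik] /andP[_ jk] /= ij.
  apply/negP => /perm_mem E'.
  (* If the triples coincided, each of [i], [j] would be one or two steps after the other on the
     cycle, so [k] would be at most 4. *)
  have /(mem_cycle_triple _ jk) hi : i \in cycle_triple k j by rewrite -E' mem_head.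
  have /(mem_cycle_triple _ ik) hj : j \in cycle_triple k i by rewrite E' mem_head.
  by lia.
- rewrite all_map; apply: all_iota => i ik /=.
  by have [h1 h2] := cycle_succ_lt ik; have [h3 h4] := cycle_succ_lt h1; lia.
- move=> i j ik jk ij _; rewrite /codeg count_map.
  apply/(count_gt1P _ (iota_uniq 0 k))/idP => [[a [b [+ + ab]]]|].
    rewrite !mem_iota !add0n => /andP[_ ak] /andP[_ bk] /andP[/= ia ja] /andP[/= ib jb].
    move: ia ja ib jb => /(mem_cycle_triple _ ak) ? /(mem_cycle_triple _ ak) ?.
    move=> /(mem_cycle_triple _ bk) ? /(mem_cycle_triple _ bk) ?.
    have [h|h] : (j = i.+1 \/ j + k = i.+1) \/ (i = j.+1 \/ i + k = j.+1) by lia.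
      by apply/orP; left; apply/mem_cycle_pairs.
    by apply/orP; right; apply/mem_cycle_pairs.
  have main a b : a < k -> (a, b) \in cycle_pairs k -> exists e f,
      [/\ e \in iota 0 k, f \in iota 0 k, e != f,
       (a \in cycle_triple k e) && (b \in cycle_triple k e) &
       (a \in cycle_triple k f) && (b \in cycle_triple k f)].
    move=> ak /(mem_cycle_pairs _ ak) ab; exists a.
    (* The second triple starts at [d], the predecessor of [a] on the cycle. *)
    have [d da dk] : exists2 d, a = d.+1 \/ a + k = d.+1 & d < k.
      by case: a ak {ab} => [|a] ak; [exists k.-1; lia | exists a; lia].
    exists d; rewrite !mem_iota; split; [by lia | by lia | by lia | | ].
      by apply/andP; split; apply/mem_cycle_triple => //; lia.
    by apply/andP; split; apply/mem_cycle_triple => //; lia.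
  case/orP=> /main => [/(_ ik) //|/(_ jk)] [e [f [ek fk ef ee ff]]].
  by exists e, f; split; rewrite //= andbC.
rewrite all_map; apply: all_iota => i ik /=.
by have [h1 h2] := cycle_succ_lt ik; lia.
Qed.

End Cactus.

(** * Growing the state by a cycle or a bridge *)

Section Growth.
Variables (T : finType) (E : {set {set T}}).
Hypothesis cactusE : cactus E.
Implicit Types (x y z u v w : T) (c p q : seq T) (S : {set T}) (H : seq (seq T)).

Lemma state_long_cycle S H r x0 c m : core E S H ->
    (forall u, u \in S -> ready E S H r u) ->
    ucycle (adj E) c -> 4 < size c -> m <= 1 ->
    (forall i, i < size c -> (nth x0 c i \in S) = (i < m)) ->
    S = set0 \/ (exists2 u, u \in c & u \in S) ->
  exists H', state E (S :|: [set x in c]) H' r.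
Proof.
move=> coreH rS cE c5 m1 cS uS.
have Ec : map (nth x0 c) (iota 0 (size c)) = c by rewrite map_nth_iota0 // take_size.
eexists; apply: (@state_cycle _ E cactusE x0 S H c m (cycle_triples (size c))
  (iota 0 (size c))) => //; rewrite ?Ec ?zip_rot1_iota ?(ucycle_uniq cE) //.
- exact: cycle_gadget.
- by move=> i j im jm; rewrite neq_ltn; lia.
- by apply/allP => i; rewrite mem_iota.
- exact: ltn_trans c5.
apply: leq_trans (subset_leq_card (subsetUr _ _)).
by rewrite cardsE (card_uniqP (ucycle_uniq cE)) (ltn_trans _ c5).
Qed.

Lemma state_nbr S H r u : state E S H r -> u \in S -> exists2 w, w \in S & heavy H u w.
Proof.
case=> coreH S4 _ uS; have : 0 < #|S :\ u| by rewrite (cardsD1 u) uS in S4; lia.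
case/card_gt0P=> y; rewrite !inE => /andP[yu yS].
case/connectP: (core_conn coreH uS yS) => -[|w p] /=; first by move=> _ e; rewrite e eqxx in yu.
by case/andP=> uw _ _; exists w => //; apply: core_heavyS coreH uw.
Qed.

Lemma state_others S H r u w : state E S H r -> u \in S -> w \in S -> u != w ->
  exists z z', [/\ z \in S, z' \in S & uniq [:: u; w; z; z']].
Proof.
case=> coreH S4 _ uS wS uw.
have : 1 < #|S :\ u :\ w|.
  by move: S4; rewrite (cardsD1 u) uS (cardsD1 w (S :\ u)) !inE eq_sym uw wS; lia.
case/card_gt1P=> z [z' []]; rewrite !inE => /and3P[zw zu zS] /and3P[zw' zu' zS'] zz'.
exists z, z'; split=> //=; rewrite !inE !negb_or uw zz'.
by rewrite ![u == _]eq_sym ![w == _]eq_sym zw zu zw' zu'.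
Qed.

Lemma card_glue S (s : seq T) v : v \in s -> v \notin S -> #|S| < #|S :|: [set x in s]|.
Proof.
move=> vs vS; apply/proper_card/properP; split; first exact: subsetUl.
by exists v => //; rewrite !inE vs orbT.
Qed.

(** The triples are uab, uaw, ubw, abz, with [w] a neighbour of [u]. Each side of the triangle lies
    in two of them, and uw is the only old pair they cover. *)
Lemma state_triangle S H r u a b : state E S H r -> u \in S ->
    ucycle (adj E) [:: u; a; b] -> a \notin S -> b \notin S ->
  exists S' H', state E S' H' r /\ #|S| < #|S'|.
Proof.
move=> st uS cE aS bS; have [w wS uw] := state_nbr st uS.
have [z [z' [zS _ /=]]] := state_others st uS wS (andP uw).1.
rewrite !inE !negb_or !andbT => /and3P[/and3P[nuw uz _] /andP[wz _] _].
have /= := ucycle_uniq cE; rewrite !inE negb_or andbT => /andP[/andP[ua ub] ab].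
have nS x y : x \in S -> y \notin S -> x != y by move=> xS; apply: contraNneq => <-.
set s := [:: u; w; z; a; b].
have us : uniq s by rewrite /= !inE !negb_or nuw uz ua ub wz ab !nS.
exists (S :|: [set x in s]); eexists; split; last first.
  by apply: (card_glue (v := a)) => //; rewrite !inE eqxx !orbT.
apply: (@state_cycle _ E cactusE u S H s 3
  [:: [:: 0; 3; 4]; [:: 0; 3; 1]; [:: 0; 4; 1]; [:: 3; 4; 2]] [:: 0; 3; 4]) => //.
- exact: state_core st.
- exact: gadgetP.
- by case=> [|[|[|[|[|i]]]]] //= _; rewrite ?uS ?wS ?zS ?(negPf aS) ?(negPf bS).
- by case=> [|[|[|i]]] // [|[|[|j]]] //= _ _ _ _; rewrite heavy_sym.
- by right; exists u => //; rewrite mem_head.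
- move=> x; rewrite !inE => /or4P[/eqP->|/eqP->|/eqP->|].
  - by rewrite uS.
  - by rewrite wS.
  - by rewrite zS.
  - by move=> /orP[]/eqP->; rewrite eqxx !orbT.
- exact: state_ready st.
exact: leq_trans (state_card st) (subset_leq_card (subsetUl _ _)).
Qed.

(** The triples are cua, uab, ucw, abw, bcz, bcz'. Each side lies in two of them, the diagonals ac
    and ub in one each, and uw is the only old pair covered. *)
Lemma state_square S H r u a b (c : T) : state E S H r -> u \in S ->
    ucycle (adj E) [:: u; a; b; c] -> a \notin S -> b \notin S -> c \notin S ->
  exists S' H', state E S' H' r /\ #|S| < #|S'|.
Proof.
move=> st uS cE aS bS cS; have [w wS uw] := state_nbr st uS.
have [z [z' [zS zS' /=]]] := state_others st uS wS (andP uw).1.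
rewrite !inE !negb_or !andbT => /and3P[/and3P[nuw uz uz'] /andP[wz wz'] zz'].
have /= := ucycle_uniq cE; rewrite !inE !negb_or andbT.
move=> /and3P[/and3P[ua ub uc] /andP[ab ac] bc].
have nS x y : x \in S -> y \notin S -> x != y by move=> xS; apply: contraNneq => <-.
set s := [:: u; w; z; z'; a; b; c].
have us : uniq s by rewrite /= !inE !negb_or nuw uz uz' ua ub uc wz wz' zz' ab ac bc !nS.
exists (S :|: [set x in s]); eexists; split; last first.
  by apply: (card_glue (v := a)) => //; rewrite !inE eqxx !orbT.
apply: (@state_cycle _ E cactusE u S H s 4
  [:: [:: 6; 0; 4]; [:: 0; 4; 5]; [:: 0; 6; 1]; [:: 4; 5; 1]; [:: 5; 6; 2];
      [:: 5; 6; 3]] [:: 0; 4; 5; 6]) => //.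
- exact: state_core st.
- exact: gadgetP.
- case=> [|[|[|[|[|[|[|i]]]]]]] //= _;
  by rewrite ?uS ?wS ?zS ?zS' ?(negPf aS) ?(negPf bS) ?(negPf cS).
- by case=> [|[|[|[|i]]]] // [|[|[|[|j]]]] //= _ _ _ _; rewrite heavy_sym.
- by right; exists u => //; rewrite mem_head.
- move=> x; rewrite !inE => /or4P[/eqP->|/eqP->|/eqP->|/or4P[]/eqP->].
  - by rewrite uS.
  - by rewrite wS.
  - by rewrite zS.
  - by rewrite zS'.
  - by rewrite eqxx !orbT.
  - by rewrite eqxx !orbT.
  - by rewrite eqxx !orbT.
- exact: state_ready st.
exact: leq_trans (state_card st) (subset_leq_card (subsetUl _ _)).
Qed.

(** By [ear_cycle] the cycle meets [S] in [u] alone; its length then selects the gadget. *)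
Lemma state_add_cycle S H r u v c : state E S H r -> u \in S -> v \notin S ->
    ucycle (adj E) [:: u, v & c] -> 0 < size c ->
  exists S' H', state E S' H' r /\ #|S| < #|S'|.
Proof.
move=> st uS vS cE c0; have coreH := state_core st.
have cS : forall z, z \in v :: c -> z \notin S.
  apply: (ear_cycle (heavy_sym H) _ _ _ _ uS vS cE).
  - by move=> x y; apply: core_heavyS coreH.
  - exact: core_adj coreH.
  - exact: core_conn coreH.
  - exact: core_cyc coreH.
case: c c0 cE cS => [|a [|b [|d c]]] // _ cE cS.
- by apply: state_triangle st uS cE _ _; apply: cS; rewrite !inE eqxx ?orbT.
- by apply: state_square st uS cE _ _ _; apply: cS; rewrite !inE eqxx ?orbT.
have [||H' st'] := @state_long_cycle S H r u [:: u, v, a, b, d & c] 1 coreH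
    (state_ready st) cE isT isT.
- case=> [|i] ilt; first by rewrite uS.
  by apply/negbTE/cS; apply: (@mem_nth _ u [:: v, a, b, d & c]).
- by right; exists u; rewrite // mem_head.
exists (S :|: [set x in [:: u, v, a, b, d & c]]), H'; split=> //.
by apply: card_glue vS; rewrite !inE eqxx orbT.
Qed.

(** The triples are vuw and vuz. If uz is a reserved pair, its codegree rises from 0 to 1 and the
    reservation is spent; [u] now has the two neighbours [w] and [v]. *)
Lemma state_add_pendant S H r u v : state E S H r -> u \in S -> v \notin S ->
  bridge E u v -> exists S' H' r', state E S' H' r' /\ #|S| < #|S'|.
Proof.
move=> st uS vS uv; have coreH := state_core st.
have [w [z [wS zS uw nuz hz]]] : exists w z, [/\ w \in S, z \in S, heavy H u w,
    (u != z) && (w != z) & heavy H u z \/ z = r u /\ codeg H u z = 0 /\ r z <> u].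
  case: (state_ready st uS) => [[w [z [wz uw uz]]]|/(_ v uv) uv'|[ru cru rru]].
  - have [zS wS] := (core_heavyS coreH uz, core_heavyS coreH uw).
    by exists w, z; rewrite wS zS uw wz (andP uz).1 uz; split=> //; left.
  - by rewrite (core_heavyS coreH uv') in vS.
  have [w wS uw] := state_nbr st uS; exists w, (r u); rewrite wS ru uw; split=> //.
    apply/andP; split; first by apply: contra rru => /eqP e; rewrite -e -e.
    by apply: contraTneq uw => ->; rewrite /heavy cru andbF.
  by right; split=> //; split=> //; apply/eqP.
have /andP[uz wz] := nuz.
(* This fourth vertex will be reserved for the leaf [v]. Of two vertices other than [u] and [w], at
   least one is not [z]. *)
have [y yS [nyu nyw nyz]] : exists2 y, y \in S & [/\ y != u, y != w & y != z].
  have [y1 [y2 [y1S y2S /=]]] := state_others st uS wS (andP uw).1.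
  rewrite !inE !negb_or !andbT => /and3P[/and3P[_ a1 a2] /andP[b1 b2] y12].
  have [e|n1] := eqVneq y1 z.
    by exists y2; rewrite // -e ![y2 == _]eq_sym a2 b2 y12.
  by exists y1; rewrite // ![y1 == _]eq_sym a1 b1 eq_sym n1.
have nS x y' : x \in S -> y' \notin S -> x != y' by move=> xS; apply: contraNneq => <-.
set s := [:: u; w; z; v].
have us : uniq s by rewrite /= !inE !negb_or (andP uw).1 uz wz !nS.
pose B := [:: [:: 3; 0; 1]; [:: 3; 0; 2]].
have gB : gadget (size s) 3 B [:: (0, 3)] by apply: gadgetP.
have sS i : i < size s -> (nth u s i \in S) = (i < 3).
  by case: i => [|[|[|[|i]]]] //= _; rewrite ?uS ?wS ?zS ?(negPf vS).
have old i j : i < 3 -> j < 3 -> i != j -> 0 < codeg B i j ->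
    heavy H (nth u s i) (nth u s j)
    \/ codeg H (nth u s i) (nth u s j) = 0 /\ codeg B i j = 1.
  case: i => [|[|[|i]]] //; case: j => [|[|[|j]]] //= _ _ _ _; first by left.
  - by case: hz => [?|[_ [? _]]]; [left | right].
  - by left; rewrite heavy_sym.
  by rewrite heavy_sym codegC; case: hz => [?|[_ [? _]]]; [left | right].
set H' := relabel u s B ++ H.
have hH' x x' : heavy H' x x' = heavy H x x' || symp [:: (u, v)] x x'.
  exact: core_heavy_glue coreH us gB sS old x x'.
have Duv x x' : symp [:: (u, v)] x x' -> bridge E x x'.
  rewrite /symp !inE => /orP[]/eqP[-> ->] //; by rewrite bridge_sym.
(* The leaf [v] reserves [y]. A value [r x = v] belongs to no actual reservation, since those lie in
   [S]; it is reset to [x] so that [r' (r' v)] is not [v]. *)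
pose r' x := if x == v then y else if r x == v then x else r x.
exists (S :|: [set x in s]), H', r'; split; last first.
  by apply: (card_glue (v := v)) => //; rewrite !inE eqxx !orbT.
have mono : subrel (heavy H) (heavy H') by move=> x x' xx'; rewrite hH' xx'.
split.
- apply: (core_glue (u := u) coreH us gB sS old) => //.
  - by move=> x x' /Duv/bridge_adj.
  - by move=> C x x' z1 z2 CE xC /Duv; rewrite (negPf (bridge_cycles CE xC)).
  - by rewrite mem_head.
  - move=> x xS; apply: (connect_sub _ (core_conn coreH uS xS)) => a b /mono.
    exact: connect1.
  move=> x; rewrite !inE => /or4P[]/eqP->; rewrite ?uS ?wS ?zS //= => _.
  by apply: connect1; rewrite hH' /symp mem_head orbT.
- exact: leq_trans (state_card st) (subset_leq_card (subsetUl _ _)).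
move=> x; rewrite inE => xS'; have [->|xv] := eqVneq x v.
  have yv : y != v by apply: nS.
  apply: Or33; rewrite /r' eqxx (negPf yv) inE yS; split=> //; last first.
    by case: ifP => [_|/negbT].
  rewrite (codeg_glue u H us gB) /= /s /= !eqxx.
  rewrite ![_ == v](negPf (nS _ _ _ vS)) // ![_ == y]eq_sym.
  rewrite (negPf nyu) (negPf nyw) (negPf nyz) (negPf yv) /=.
  apply/eqP; rewrite add0n -leqn0 leqNgt; apply/negP.
  by case/codeg_gt0=> t [tH vt _]; rewrite (core_sub coreH tH vt) in vS.
have {xS'} xS : x \in S.
  by case/orP: xS' => //; rewrite !inE (negPf xv) orbF => /or3P[]/eqP->.
have [->|xu] := eqVneq x u.
  apply: Or31; exists w, v; rewrite nS // mono // hH' /symp mem_head orbT.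
  by split.
case: (state_ready st xS) => [[w' [z1 [wz' xw xz]]]|clx|[rxS cx rrx]].
- by apply: Or31; exists w', z1; rewrite !mono.
- by apply: Or32 => x' /clx/mono.
have rxv : r x != v by apply: nS.
have rxx : r x != x by apply: contra rrx => /eqP e; rewrite e e.
apply: Or33; rewrite /r' (negPf xv) !(negPf rxv) inE rxS; split=> //; last first.
  by case: ifP.
rewrite (codeg_glue u H us gB) cx addn0; apply/eqP; rewrite -leqn0 leqNgt.
apply/negP => cB; have /andP[xs rxs] := codeg_gadget_lt gB cB.
have := sS _ xs; have := sS _ rxs.
rewrite !nth_index -?index_mem // xS rxS => /esym rx3 /esym x3.
have Ex : nth u s (index x s) = x by rewrite nth_index -?index_mem.
have Er : nth u s (index (r x) s) = r x by rewrite nth_index -?index_mem.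
move: (index x s) (index (r x) s) Ex Er x3 rx3 cB {xs rxs}.
case=> [|[|[|i]]] // [|[|[|j]]] //= Ex Er _ _ _.
- by rewrite Ex eqxx in xu.
- by rewrite Ex eqxx in xu.
- by rewrite Ex eqxx in xu.
- by move: cx; rewrite -Er -Ex codegC => c0; move: uw; rewrite /heavy c0 andbF.
- by rewrite -Er Ex eqxx in rxx.
(* Here [x] is [z] and reserves [u]. If uz is heavy its codegree is not 0, and if [z] is [r u] then
   [r z] is not [u]. *)
- move: cx; rewrite -Er -Ex codegC => c0; case: hz => [|[_ [_]]].
    by rewrite /heavy c0 andbF.
  by rewrite Ex -Er.
by rewrite -Er Ex eqxx in rxx.
Qed.

Lemma state_grow S H r v0 : state E S H r -> v0 \notin S ->
  exists S' H' r', state E S' H' r' /\ #|S| < #|S'|.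
Proof.
move=> st v0S; have [u0 u0S] : exists u, u \in S.
  by apply/card_gt0P; apply: leq_trans (state_card st).
have [p pE ev0] : exists2 p, path (adj E) u0 p & v0 = last u0 p.
  by case: cactusE => _ /(_ u0 v0) /connectP.
have [u [v [uS vS uv]]] : exists u v, [/\ u \in S, v \notin S & adj E u v].
  elim: p u0 u0S pE ev0 => [|v p IH] u uS /=; first by move=> _ e; rewrite e uS in v0S.
  case/andP=> uv pE e; have [vS|vS] := boolP (v \in S); first exact: IH vS pE e.
  by exists u, v.
have [uvb|nuv] := boolP (bridge E u v); first exact: state_add_pendant st uS vS uvb.
have [c [cE c0]] := nonbridge_cycle uv nuv.
have [S' [H' st']] := state_add_cycle st uS vS cE c0.
by exists S', H', r.
Qed.

Lemma state_full S H r : state E S H r -> exists H' r', state E setT H' r'.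
Proof.
move: {2}(#|T| - #|S|).+1 (ltnSn (#|T| - #|S|)) => n.
elim: n S H r => // n IH S H r lt_n st.
have [eS|] := eqVneq S setT; first by exists H, r; rewrite -eS.
rewrite -subTset => /subsetPn[v _ vS].
have [S' [H' [r' [st' SS']]]] := state_grow st vS.
by apply: IH st'; have cS' : #|S'| <= #|T| := max_card _; lia.
Qed.

(** * From triples to the edge intersection hypergraph *)

Definition hyperedges H : {set {set T}} :=
  [set:: [seq [set z in t] | t : seq T <- H]].

Lemma hyperedgesP H f :
  reflect (exists2 t, t \in H & f = [set z in t]) (f \in hyperedges H).
Proof. by rewrite inE; apply: mapP. Qed.

(** Two different 3-sets that both contain [x] and [y] meet in nothing else. *)
Lemma codeg_EI H x y : triple_system H -> x != y ->
  ([set x; y] \in EI (hyperedges H)) = (1 < codeg H x y).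
Proof.
case/andP=> /allP H3 dH xy.
have c3 t : t \in H -> #|[set z in t]| = 3.
  by move=> /H3 /andP[ut /eqP <-]; rewrite cardsE; apply/card_uniqP.
apply/imset2P/idP => [[e1 e2 /hyperedgesP[t1 t1H ->]]|].
  case/setIdP=> /hyperedgesP[t2 t2H ->] /andP[t12 _] exy.
  have := set21 x y; have := set22 x y; rewrite exy !inE.
  move=> /andP[y1 y2] /andP[x1 x2]; rewrite /codeg -size_filter.
  apply: (@uniq_leq_size _ [:: t1; t2]).
    by rewrite /= inE andbT; apply: contra t12 => /eqP->.
  by move=> t; rewrite !inE mem_filter => /orP[]/eqP->; rewrite ?t1H ?t2H ?x1 ?x2 ?y1 ?y2.
rewrite /codeg -size_filter; set a := (X in filter X); move=> szf.
have := pairwise_filter a dH; have := mem_filter a ^~ H.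
case: (filter a H) szf => [|t1 [|t2 f]] //= _ mf /andP[/andP[t12 _] _].
have /andP[/andP[x1 y1] t1H] : a t1 && (t1 \in H) by rewrite -mf mem_head.
have /andP[/andP[x2 y2] t2H] : a t2 && (t2 \in H) by rewrite -mf !inE eqxx orbT.
have n12 : [set z in t1] != [set z in t2].
  apply: contra t12 => /eqP/setP e12; have [/andP[u1 _] /andP[u2 _]] := (H3 _ t1H, H3 _ t2H).
  by apply: uniq_perm => // z; have := e12 z; rewrite !inE.
have sub : [set x; y] \subset [set z in t1] :&: [set z in t2].
  by apply/subsetP => z /set2P[]->; rewrite !inE ?x1 ?x2 ?y1 ?y2.
have tE t : t \in H -> [set z in t] \in hyperedges H.
  by move=> tH; apply/hyperedgesP; exists t.
exists [set z in t1] [set z in t2]; first exact: tE.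
  apply/setIdP; split; first exact: tE.
  rewrite n12 /=.
  by apply: leq_trans (subset_leq_card sub); rewrite cards2 xy.
apply/eqP; rewrite eqEcard sub cards2 xy /= -ltnS -(c3 _ t1H).
apply: proper_card; rewrite properEneq subsetIl andbT.
apply: contra n12 => /eqP/setIidPl s12.
by rewrite eqEcard s12 !c3.
Qed.

(** Distinct 3-sets meet in at most two vertices, so all edges of the intersection hypergraph are
    heavy pairs. Conversely [ear_edge], applied to the full vertex set, makes every edge of the
    graph heavy. *)
Lemma EI_state H r : state E setT H r ->
  uniform 3 (hyperedges H) /\ E = EI (hyperedges H).
Proof.
case=> coreH _ _; have trH := core_triple coreH; have /andP[/allP H3 _] := trH.
have c3 : uniform 3 (hyperedges H).
  by move=> _ /hyperedgesP[t /H3 /andP[ut /eqP <-] ->]; rewrite cardsE; apply/card_uniqP.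
have c2 f : f \in EI (hyperedges H) -> #|f| == 2.
  case/imset2P=> e1 e2 e1H; case/setIdP=> e2H /andP[e12 c2] ->.
  rewrite eqn_leq c2 andbT -ltnS -(c3 _ e1H); apply: proper_card.
  rewrite properEneq subsetIl andbT; apply: contra e12 => /eqP/setIidPl s12.
  by rewrite eqEcard s12 !c3.
split=> //; apply/setP => f; apply/idP/idP => [fE|fH].
  have /cards2P[x [y [xy ef]]] : #|f| == 2 by case: cactusE => /(_ _ fE) ->.
  have : heavy H x y.
    apply: (@ear_edge _ E cactusE setT _ (heavy_sym H) _ (core_adj coreH) _
      (core_cyc coreH)) => //.
      exact: core_conn coreH.
    by rewrite /adj /= -ef.
  by rewrite ef codeg_EI // => /andP[].
have /cards2P[x [y [xy ef]]] := c2 f fH; rewrite ef.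
apply: (core_adj coreH); rewrite /heavy xy -codeg_EI //.
by rewrite -ef.
Qed.

End Growth.

(** * Small trees and their triples *)

(* The rooted tree with vertices 0, ..., size ps in which the parent of k + 1
   is nth 0 ps k. *)
Definition tree_pairs (ps : seq nat) : seq (nat * nat) :=
  zip ps (iota 1 (size ps)).

Definition increasing_tree (ps : seq nat) : bool :=
  all (fun e => e.1 < e.2) (tree_pairs ps).

Definition embeds (qs ps p : seq nat) : bool :=
  [&& size p == (size qs).+1, uniq p, all (gtn (size ps).+1) p &
    all (fun e => symp (tree_pairs ps) (nth 0 p e.1) (nth 0 p e.2))
      (tree_pairs qs)].

(** A search that places the vertices in order, each on a free neighbour of its parent's image. It
    only proposes candidates, which [contains] tests with [embeds]. *)
Definition embeddings (qs ps : seq nat) : seq (seq nat) :=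
  foldl (fun ls q => [seq rcons p v | p <- ls,
      v <- [seq v <- iota 0 (size ps).+1 |
              symp (tree_pairs ps) (nth 0 p q) v && (v \notin p)]])
    [seq [:: v] | v <- iota 0 (size ps).+1] qs.

Definition contains (ps qs : seq nat) : bool :=
  has (embeds qs ps) (embeddings qs ps).

(** These are P_1 to P_6, T7 and T12 in this order, numbered so that their graphs agree by
    computation with those of the theorem. *)
Definition exceptional_trees : seq (seq nat) :=
  [:: [::]; [:: 0]; [:: 0; 1]; [:: 0; 1; 2]; [:: 0; 1; 2; 3];
      [:: 0; 1; 2; 3; 4]; [:: 0; 1; 2; 2]; [:: 0; 1; 2; 1; 4]].

(* These triples admit no reservation at some leaf, so they only serve when the
   tree is an entire limb. *)
Definition rigid_trees : seq (seq nat * seq (seq nat)) := [::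
  ([:: 0; 0; 0],
   [:: [:: 0; 1; 2]; [:: 0; 1; 3]; [:: 0; 2; 3]]);
  ([:: 0; 0; 0; 0],
   [:: [:: 0; 1; 2]; [:: 0; 1; 4]; [:: 0; 2; 3]; [:: 0; 3; 4]]);
  ([:: 0; 0; 0; 0; 4],
   [:: [:: 0; 1; 2]; [:: 0; 1; 3]; [:: 0; 2; 4]; [:: 0; 3; 4];
       [:: 0; 4; 5]; [:: 1; 4; 5]]);
  ([:: 0; 0; 0; 3; 4],
   [:: [:: 0; 1; 2]; [:: 0; 1; 5]; [:: 0; 2; 3]; [:: 0; 3; 4];
       [:: 2; 4; 5]; [:: 3; 4; 5]])].

(* Each tree comes with its triples and the list of the values of r. *)
Definition reserved_trees : seq (seq nat * seq (seq nat) * seq nat) := [::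
  (([:: 0; 0; 0; 0; 0],
    [:: [:: 0; 1; 3]; [:: 0; 1; 4]; [:: 0; 2; 4]; [:: 0; 2; 5]; [:: 0; 3; 5]]),
   [:: 0; 2; 3; 4; 5; 1]);
  (([:: 0; 0; 0; 3; 3],
    [:: [:: 0; 1; 2]; [:: 0; 1; 3]; [:: 0; 2; 3]; [:: 0; 3; 4];
       [:: 0; 3; 5]; [:: 3; 4; 5]]),
   [:: 0; 4; 5; 3; 2; 1]);
  (([:: 0; 1; 2; 3; 4; 5],
    [:: [:: 0; 1; 2]; [:: 0; 1; 4]; [:: 0; 5; 6]; [:: 1; 2; 3];
       [:: 2; 3; 4]; [:: 3; 4; 5]; [:: 4; 5; 6]]),
   [:: 3; 1; 2; 3; 4; 5; 1]);
  (([:: 0; 1; 2; 3; 4; 1],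
    [:: [:: 0; 1; 2]; [:: 0; 1; 6]; [:: 1; 2; 3]; [:: 1; 2; 6];
       [:: 2; 3; 4]; [:: 3; 4; 5]; [:: 4; 5; 6]]),
   [:: 3; 1; 2; 3; 4; 0; 3]);
  (([:: 0; 1; 2; 3; 4; 2],
    [:: [:: 0; 1; 2]; [:: 0; 1; 3]; [:: 1; 2; 6]; [:: 2; 3; 4];
       [:: 2; 3; 6]; [:: 3; 4; 5]; [:: 4; 5; 6]]),
   [:: 4; 1; 2; 3; 4; 0; 0]);
  (([:: 0; 1; 2; 1; 4; 0],
    [:: [:: 0; 1; 2]; [:: 0; 1; 4]; [:: 0; 1; 6]; [:: 0; 3; 6];
       [:: 1; 2; 3]; [:: 1; 4; 5]; [:: 2; 3; 5]; [:: 4; 5; 6]]),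
   [:: 0; 1; 2; 4; 4; 0; 2]);
  (([:: 0; 1; 2; 1; 4; 1],
    [:: [:: 0; 1; 2]; [:: 0; 1; 6]; [:: 0; 4; 5]; [:: 1; 2; 3];
       [:: 1; 4; 5]; [:: 1; 4; 6]; [:: 2; 3; 4]]),
   [:: 3; 1; 2; 5; 4; 2; 2]);
  (([:: 0; 0; 0; 0; 4; 5],
    [:: [:: 0; 1; 2]; [:: 0; 1; 3]; [:: 0; 2; 4]; [:: 0; 3; 4];
       [:: 0; 4; 5]; [:: 3; 5; 6]; [:: 4; 5; 6]]),
   [:: 0; 4; 5; 2; 4; 5; 0]);
  (([:: 0; 0; 0; 3; 4; 4],
    [:: [:: 0; 1; 2]; [:: 0; 1; 3]; [:: 0; 2; 3]; [:: 3; 4; 5];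
       [:: 3; 4; 6]; [:: 4; 5; 6]]),
   [:: 0; 4; 4; 3; 4; 0; 0])].

Definition small_trees : seq (seq nat) := exceptional_trees ++ map fst rigid_trees.

Lemma small_trees_increasing : all increasing_tree small_trees.
Proof. by []. Qed.

Lemma small_trees_size : all (fun ps => size ps < 6) small_trees.
Proof. by []. Qed.

(** As [qs] has as many vertices as the extended tree, containment is an isomorphism. So growth leaf
    by leaf either stays among the small trees, which have at most six vertices, or reaches a
    reserved tree. *)
Lemma small_trees_grow : all (fun ps => all (fun i =>
    has (fun qs => (size qs == (size ps).+1) && contains (rcons ps i) qs)
      small_trees
    || has (fun c => contains (rcons ps i) c.1.1) reserved_trees)
  (iota 0 (size ps).+1)) small_trees.
Proof. by vm_compute. Qed.

Lemma rigid_trees_gadget :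
  all (fun c => (2 < size c.1)
    && gadgetb (size c.1).+1 0 c.2 (tree_pairs c.1)) rigid_trees.
Proof. by vm_compute. Qed.

Definition reservedb (ps : seq nat) (B : seq (seq nat)) (r : seq nat) : bool :=
  let n := (size ps).+1 in
  [&& increasing_tree ps, 2 < size ps, gadgetb n 0 B (tree_pairs ps),
    all (gtn n) r &
    all (fun i => (1 < count (symp (tree_pairs ps) i) (iota 0 n)) ||
      [&& nth 0 r i < n, codeg B i (nth 0 r i) == 0 &
          nth 0 r (nth 0 r i) != i]) (iota 0 n)].

Lemma reserved_trees_reserved :
  all (fun c => reservedb c.1.1 c.1.2 c.2) reserved_trees.
Proof. by vm_compute. Qed.

(** * Trees of bridges and limbs *)

Section Trees.
Variables (T : finType) (E : {set {set T}}) (x0 : T).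
Hypothesis cactusE : cactus E.
Implicit Types (x y z u v w : T) (s : seq T) (ps qs p : seq nat).

Record bridge_tree ps s : Prop := BridgeTree {
  bt_uniq : uniq s;
  bt_size : size s = (size ps).+1;
  bt_incr : increasing_tree ps;
  bt_bridge : forall e, e \in tree_pairs ps ->
    bridge E (nth x0 s e.1) (nth x0 s e.2) }.

Definition tree_rel ps s : rel T := symp (relabel_pairs x0 s (tree_pairs ps)).

Lemma tree_pairs_lt ps e : increasing_tree ps -> e \in tree_pairs ps ->
  (e.1 < e.2) && (e.2 < (size ps).+1).
Proof.
move=> /allP incr ee; rewrite incr //=.
have : e.2 \in unzip2 (tree_pairs ps) by rewrite map_f.
by rewrite unzip2_zip ?size_iota // mem_iota add1n => /andP[].
Qed.

Lemma tree_relE ps s x y : bridge_tree ps s ->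
  tree_rel ps s x y = symp (tree_pairs ps) (index x s) (index y s).
Proof.
move=> bt; rewrite /tree_rel symp_relabel ?(bt_uniq bt) //.
apply/allP => e /(tree_pairs_lt (bt_incr bt)) /andP[e12 e2].
by rewrite (bt_size bt) e2 (ltn_trans e12 e2).
Qed.

Lemma tree_rel_bridge ps s : bridge_tree ps s -> subrel (tree_rel ps s) (bridge E).
Proof.
move=> bt x y /orP[]/mapP[e /(bt_bridge bt) ee [-> ->]] //.
by rewrite bridge_sym.
Qed.

Lemma tree_rel_mem ps s x y : bridge_tree ps s -> tree_rel ps s x y -> y \in s.
Proof.
move=> bt; rewrite tree_relE // -index_mem (bt_size bt).
case/orP=> /(tree_pairs_lt (bt_incr bt)) /andP[/= e12 e2] //.
exact: ltn_trans e2.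
Qed.

Lemma tree_cycle_closed (F : rel T) : subrel F (bridge E) -> cycle_closed E F.
Proof. by move=> Fb C x y z t CE xyC /Fb; rewrite (negPf (bridge_cycles CE xyC)). Qed.

Lemma tree_rel_connect0 ps s i : bridge_tree ps s -> i < size s ->
  connect (tree_rel ps s) (nth x0 s 0) (nth x0 s i).
Proof.
move=> bt; elim/ltn_ind: i => -[|i] IH; first by rewrite connect0.
rewrite (bt_size bt) ltnS => ip.
have ee : (nth 0 ps i, i.+1) \in tree_pairs ps.
  rewrite (_ : (_, _) = nth (0, 0) (tree_pairs ps) i); last first.
    by rewrite nth_zip ?size_iota // nth_iota.
  by rewrite mem_nth // size_zip size_iota minnn.
have /andP[/= pi _] := tree_pairs_lt (bt_incr bt) ee.
apply: connect_trans (IH _ pi _) (connect1 _); first by rewrite (bt_size bt); lia.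
rewrite tree_relE // !index_uniq ?(bt_uniq bt) ?(bt_size bt) //; try lia.
by rewrite /symp ee.
Qed.

Lemma tree_rel_connect ps s x y : bridge_tree ps s -> x \in s -> y \in s ->
  connect (tree_rel ps s) x y.
Proof.
move=> bt xs ys.
have c0 z : z \in s -> connect (tree_rel ps s) (nth x0 s 0) z.
  by move=> zs; rewrite -(nth_index x0 zs); apply: tree_rel_connect0; rewrite ?index_mem.
apply: connect_trans (c0 _ ys).
by rewrite (sym_connect_sym (@symp_sym _ _)) c0.
Qed.

(** Bridges lie on no cycle, so the tree is trivially closed under cycles and [ear_edge] applies to
    it. *)
Lemma tree_rel_adj ps s x y : bridge_tree ps s -> x \in s -> y \in s ->
  adj E x y -> tree_rel ps s x y.
Proof.
move=> bt xs ys; apply: (@ear_edge _ E cactusE [set z in s]); rewrite ?inE //.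
- exact: symp_sym.
- by move=> a b /(tree_rel_mem bt); rewrite inE.
- by move=> a b /(tree_rel_bridge bt)/bridge_adj.
- by move=> a b; rewrite !inE; apply: tree_rel_connect.
exact/tree_cycle_closed/tree_rel_bridge.
Qed.

(** The whole tree is glued to the empty core, with no old vertex. *)
Lemma core_tree ps s B : bridge_tree ps s -> gadgetb (size ps).+1 0 B (tree_pairs ps) ->
  core E [set x in s] (relabel x0 s B) /\ heavy (relabel x0 s B) =2 tree_rel ps s.
Proof.
move=> bt /gadgetP; rewrite -(bt_size bt) => gB.
have sS i : i < size s -> (nth x0 s i \in (set0 : {set T})) = (i < 0) by rewrite inE.
have hE x y : heavy (relabel x0 s B ++ [::]) x y = tree_rel ps s x y.
  rewrite (core_heavy_glue (core0 E) (bt_uniq bt) gB sS) //.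
  by rewrite /heavy andbF.
split; last by move=> x y; rewrite -hE cats0.
rewrite -[relabel x0 s B]cats0 -[X in core E X _]set0U.
have s0 : nth x0 s 0 \in s by rewrite mem_nth // (bt_size bt).
apply: (core_glue (core0 E) (bt_uniq bt) gB sS _ _ _ s0) => //.
- by move=> x y /(tree_rel_bridge bt)/bridge_adj.
- exact/tree_cycle_closed/tree_rel_bridge.
- by move=> x; rewrite inE.
by move=> x xs _; rewrite (eq_connect hE) tree_rel_connect.
Qed.

(** As no bridge leaves [s], every vertex falls under the second case of [ready]; the map [id] is a
    placeholder. *)
Lemma state_rigid_tree ps s B : bridge_tree ps s -> 2 < size ps ->
    gadgetb (size ps).+1 0 B (tree_pairs ps) ->
    (forall x y, x \in s -> bridge E x y -> y \in s) ->
  state E [set x in s] (relabel x0 s B) id.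
Proof.
move=> bt ps2 gB cl; have [coreH hE] := core_tree bt gB; split=> //.
  by rewrite cardsE (card_uniqP (bt_uniq bt)) (bt_size bt).
move=> x; rewrite inE => xs; apply: Or32 => y xy.
rewrite hE; apply: (tree_rel_adj bt xs _ (bridge_adj xy)).
exact: cl xs xy.
Qed.

Lemma state_reserved_tree ps s B r : bridge_tree ps s -> reservedb ps B r ->
  state E [set x in s] (relabel x0 s B) (fun x => nth x0 s (nth 0 r (index x s))).
Proof.
move=> bt /and5P[_ ps2 gB rn /allP res]; have [coreH hE] := core_tree bt gB; split=> //.
  by rewrite cardsE (card_uniqP (bt_uniq bt)) (bt_size bt).
move=> x; rewrite inE => xs.
have xi : index x s < (size ps).+1 by rewrite -(bt_size bt) index_mem.
have ii : index x s \in iota 0 (size ps).+1 by rewrite mem_iota.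
have /orP[] := res _ ii.
  case/(count_gt1P _ (iota_uniq _ _))=> i [j [+ + ij xi' xj]].
  rewrite !mem_iota !add0n -(bt_size bt) => /andP[_ il] /andP[_ jl].
  apply: Or31; exists (nth x0 s i), (nth x0 s j); rewrite !hE !tree_relE //.
  by rewrite !index_uniq ?(bt_uniq bt) // nth_uniq ?(bt_uniq bt).
case/and3P; rewrite -(bt_size bt) => rlt /eqP c0 rr.
have lt : all (all (gtn (size s))) B by rewrite (bt_size bt); case/gadgetP: gB.
apply: Or33; rewrite inE mem_nth // codeg_relabel ?(bt_uniq bt) //.
rewrite index_uniq ?(bt_uniq bt) //; split=> //.
set k := nth 0 r (nth 0 r _) in rr *; have kn : k < size s.
  rewrite (bt_size bt) /k; set l := (X in nth 0 r X).
  (* Beyond the end of [r] the default 0 is still the number of a vertex. *)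
  have [lr|/(nth_default 0)->] := ltnP l (size r); last by [].
  by apply: (allP rn); rewrite mem_nth.
by apply: contra rr => /eqP <-; rewrite index_uniq ?(bt_uniq bt).

Qed.

Lemma bridge_tree_rcons ps s u v : bridge_tree ps s -> u \in s -> v \notin s ->
  bridge E u v -> bridge_tree (rcons ps (index u s)) (rcons s v).
Proof.
move=> bt us vs uv; have Ep : tree_pairs (rcons ps (index u s)) =
    rcons (tree_pairs ps) (index u s, (size ps).+1).
  rewrite /tree_pairs size_rcons.
  have -> : iota 1 (size ps).+1 = rcons (iota 1 (size ps)) (size ps).+1.
    by rewrite -{1}[(size ps).+1]addn1 iotaD cats1 add1n.
  by rewrite zip_rcons ?size_iota.
have ui : index u s < (size ps).+1 by rewrite -(bt_size bt) index_mem.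
split; rewrite ?rcons_uniq ?vs ?(bt_uniq bt) ?size_rcons ?(bt_size bt) //.
  by rewrite /increasing_tree Ep all_rcons /= ui; apply: bt_incr bt.
move=> e; rewrite Ep mem_rcons inE => /orP[/eqP->|ee] /=.
  rewrite !nth_rcons (bt_size bt) ui ltnn eqxx nth_index //.
have /andP[e12 e2] := tree_pairs_lt (bt_incr bt) ee.
by rewrite !nth_rcons (bt_size bt) e2 (ltn_trans e12 e2) (bt_bridge bt ee).
Qed.

Lemma bridge_tree_embeds ps qs s p : bridge_tree ps s -> increasing_tree qs ->
  embeds qs ps p -> bridge_tree qs (map (nth x0 s) p).
Proof.
move=> bt incr /and4P[/eqP szp up /allP plt /allP pE]; split=> //.
- rewrite map_inj_in_uniq // => i j /plt /= il /plt /= jl /eqP.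
  by rewrite nth_uniq ?(bt_uniq bt) ?(bt_size bt) // => /eqP.
- by rewrite size_map.
move=> e ee; have /andP[e12 e2] := tree_pairs_lt incr ee.
rewrite !(nth_map 0) ?szp // ?(ltn_trans e12 e2) //.
by case/orP: (pE e ee) => /(bt_bridge bt) //=; rewrite bridge_sym.
Qed.

(** The tree gains a leaf as long as a bridge leaves [s], and [small_trees_grow] tells what results.
    Once no bridge leaves, [s] is the whole component of [x] under bridges. *)
Lemma small_tree_growth ps s x : bridge_tree ps s -> ps \in small_trees ->
    (forall y, y \in s -> connect (bridge E) x y) ->
  (exists S H r, state E S H r) \/
  exists qs t, [/\ bridge_tree qs t, qs \in small_trees & t =i connect (bridge E) x].
Proof.
have [n] := ubnP (6 - size ps); elim: n ps s => // n IH ps s lt_n bt psN sx.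
have [/existsP[u /existsP[v /and3P[us uv vs]]]|ncl] :=
    boolP [exists u, exists v, [&& u \in s, bridge E u v & v \notin s]]; last first.
  right; exists ps, s; split=> // y; apply/idP/idP => [/sx //|xy].
  have bsym : connect_sym (bridge E) := sym_connect_sym (bridge_sym E).
  have cl : closed (bridge E) (mem s).
    apply: intro_closed => // a b ab aS; apply/negPn/negP => bs; case/negP: ncl.
    by apply/existsP; exists a; apply/existsP; exists b; rewrite [a \in s]aS ab.
  have s0 : nth x0 s 0 \in s by rewrite mem_nth // (bt_size bt).
  by rewrite -(closed_connect cl xy) (closed_connect cl (sx _ s0)).
have bt' := bridge_tree_rcons bt us vs uv.
have sx' y : y \in rcons s v -> connect (bridge E) x y.
  rewrite mem_rcons inE => /orP[/eqP->|/sx //].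
  exact: connect_trans (sx u us) (connect1 uv).
have ii : index u s \in iota 0 (size ps).+1.
  by rewrite mem_iota -(bt_size bt) index_mem.
have := allP (allP small_trees_grow _ psN) _ ii => /orP[/hasP[qs qsN]|].
  case/andP=> /eqP szq /hasP[p _ pE].
  have incr := allP small_trees_increasing _ qsN.
  apply: IH (bridge_tree_embeds bt' incr pE) qsN _.
    have := allP small_trees_size _ psN; lia.
  move=> y /mapP[i ip ->]; apply/sx'/mem_nth.
  case/and4P: pE => _ _ /allP /(_ _ ip) /= + _.
  by rewrite (bt_size bt').
case/hasP=> c cR /hasP[p _ pE].
have cres := allP reserved_trees_reserved _ cR.
have incr : increasing_tree c.1.1 by case/and5P: cres.
have st := state_reserved_tree (bridge_tree_embeds bt' incr pE) cres.
by left; do 3!eexists; exact: st.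
Qed.

(** A vertex on a cycle that also has a bridge has degree at least 3. So deleting the cycle vertices
    of degree 2 spares all ends of bridges, and each limb is a component of the graph of bridges. *)
Lemma bridge_limb_vertices x y : bridge E x y -> x \in limb_vertices E.
Proof.
move=> xy; rewrite inE negb_and orbC -implybE; apply/implyP.
case/bigcupP=> f /bigcupP[C CE fC] xf; apply/negP => /eqP d2.
have /cyclesP[c [c2 cE eC]] := CE; have uc := ucycle_uniq cE.
have xc : x \in c.
  move: fC xf; rewrite eC => /imsetP[z zc ->] /set2P[] -> //.
  by rewrite mem_next.
have [a [b [ab xa xb]]] := cycle_pairs_deg2 uc c2 xc.
rewrite -!mem_cycle_edges // -eC in xa xb.
have sub : [set [set x; a]; [set x; b]; [set x; y]] \subset [set f in E | x \in f].
  apply/subsetP => g; rewrite !inE => /orP[/orP[]|]/eqP->; rewrite set21 andbT.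
  - exact: subsetP (cycles_sub CE) _ xa.
  - exact: subsetP (cycles_sub CE) _ xb.
  exact: bridge_adj xy.
have ny z : [set x; z] \in C -> [set x; z] != [set x; y].
  by move=> zC; apply: contraTneq xy => e; apply: (bridge_cycles CE); rewrite -e.
have nab : [set x; a] != [set x; b].
  rewrite set2_eq eqxx /= (negPf ab) /=; apply/negP => /andP[/eqP e1 /eqP e2].
  by rewrite -e1 e2 eqxx in ab.
have := subset_leq_card sub; rewrite [X in _ <= X]d2.
have nay : [set x; y] \notin [set [set x; a]; [set x; b]].
  by apply/negP => /set2P[] e; [have := ny _ xa | have := ny _ xb]; rewrite e eqxx.
by rewrite setUC cardsU1 nay cards2 nab.
Qed.

Lemma limb_forest_bridge x y : ([set x; y] \in limb_forest E) = bridge E x y.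
Proof.
apply/setIdP/idP => [[xyE /andP[xyC _]]|xy]; first by apply/andP.
have /andP[xyE xyC] := xy; split=> //; rewrite xyC /=.
apply/subsetP => z /set2P[]->; first exact: bridge_limb_vertices xy.
by apply: (bridge_limb_vertices (y := x)); rewrite bridge_sym.
Qed.

Lemma limb_connect W : W \in limbs E ->
  exists x, W = [set y | connect (bridge E) x y].
Proof.
case/imsetP=> x _ ->; exists x; apply/setP => y; rewrite !inE.
by apply: eq_connect => a b; apply: limb_forest_bridge.
Qed.

(** The limb has no edge beyond those of the tree, by [tree_rel_adj]. *)
Lemma bridge_tree_isomorphic ps s (W : {set T}) : bridge_tree ps s -> W =i s ->
  isomorphic W (limb_edges E W) (graph_of (size ps).+1 (tree_pairs ps)).
Proof.
move=> bt Ws; have us := bt_uniq bt; have szs := bt_size bt.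
exists (fun i : 'I_(size ps).+1 => nth x0 s i); split.
- move=> i j /eqP; rewrite nth_uniq ?szs // => /eqP; exact: val_inj.
- apply/setP => x; rewrite Ws; apply/imsetP/idP => [[i _ ->]|xs].
    by rewrite mem_nth ?szs.
  have xi : index x s < (size ps).+1 by rewrite -szs index_mem.
  exists (Ordinal xi); first by rewrite inE.
  by rewrite /= nth_index.
set h := fun i : 'I_(size ps).+1 => _.
apply/setP => f; apply/imsetP/setIdP => [[g]|[fF fW]].
  case/imset2P=> i j _ /setIdP[_ ij] -> ->.
  rewrite imsetU1 imset_set1 limb_forest_bridge (bt_bridge bt ij); split=> //.
  by apply/subsetP => z /set2P[]->; rewrite Ws mem_nth ?szs.
have /cards2P[x [y [xy ef]]] : #|f| == 2.
  by case: cactusE => /(_ f) -> //; case/setIdP: fF.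
have [xs ys] : x \in s /\ y \in s.
  by rewrite -!Ws; split; apply: (subsetP fW); rewrite ef ?set21 ?set22.
have xi : index x s < (size ps).+1 by rewrite -szs index_mem.
have yi : index y s < (size ps).+1 by rewrite -szs index_mem.
exists [set Ordinal xi; Ordinal yi].
  have := fF; rewrite ef limb_forest_bridge => /bridge_adj.
  move=> /(tree_rel_adj bt xs ys); rewrite tree_relE // => /orP[] e.
    by apply/imset2P; exists (Ordinal xi) (Ordinal yi) => //; apply/setIdP.
  apply/imset2P; exists (Ordinal yi) (Ordinal xi) => //; last exact: setUC.
  exact/setIdP.
by rewrite imsetU1 imset_set1 /h /= !nth_index.
Qed.

(** Growth from the single vertex [x] either yields a state or ends with a small tree spanning the
    limb. The latter is rigid, as the exceptional trees are excluded. *)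
Lemma state_limb W : W \in limbs E ->
    (forall ps, ps \in exceptional_trees ->
      ~ isomorphic W (limb_edges E W) (graph_of (size ps).+1 (tree_pairs ps))) ->
  exists S H r, state E S H r.
Proof.
case/limb_connect=> x EW nW.
have bt : bridge_tree [::] [:: x] by split.
have [|//|[ps [s [bt' psN sx]]]] := small_tree_growth (x := x) bt (mem_head _ _).
  by move=> y; rewrite inE => /eqP->; apply: connect0.
have Ws : W =i s by move=> y; rewrite EW inE sx.
move: psN; rewrite mem_cat => /orP[/nW nps|].
  by case: nps; apply: bridge_tree_isomorphic bt' Ws.
case/mapP=> c /(allP rigid_trees_gadget) /andP[c2 cg] ec; rewrite ec in bt'.
do 3!eexists; apply: state_rigid_tree bt' c2 cg _ => u v.
rewrite !sx => xu uv; exact: connect_trans xu (connect1 uv).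
Qed.

End Trees.

(** * The long initial cycle and the conclusion *)

Lemma state_circumference (T : finType) (E : {set {set T}}) : cactus E ->
  5 <= circumference E -> exists S H r, state E S H r.
Proof.
move=> cactusE c5.
have [C CE C5] : exists2 C, C \in cycles E & 4 < #|C|.
  apply/exists_inP; apply: contraLR c5 => /exists_inPn nC; rewrite -ltnNge ltnS.
  by apply/bigmax_leqP => C /nC; rewrite -leqNgt.
(* A traversal has at least as many vertices as edges, so five edges give five vertices. *)
case/cyclesP: CE C5 => c [c2 cE ->] => /leq_trans/(_ (leq_imset_card _ _)).
rewrite (card_uniqP (ucycle_uniq cE)) => {}c5.
have [x0 _] : exists x0 : T, true by case: c c2 {cE c5} => // x; exists x.
have [|||H' st] := @state_long_cycle _ E cactusE set0 [::] id x0 c 0 (core0 E) _ cE c5 isT.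
- by move=> u; rewrite inE.
- by move=> i _; rewrite inE.
- by left.
by do 3!eexists; apply: st.
Qed.

Theorem theorem6 (T : finType) (E : {set {set T}})
    (cactusE : cactus E)
    (hyp : 5 <= circumference E \/
      exists2 W : {set T}, W \in limbs E &
        [/\ forall n : nat, 1 <= n <= 6 ->
              ~ isomorphic W (limb_edges E W) (P_ n),
            ~ isomorphic W (limb_edges E W) T7 &
            ~ isomorphic W (limb_edges E W) T12]) :
  exists2 H : {set {set T}}, uniform 3 H & E = EI H.
Proof.
have [S [H [r st]]] : exists S H r, state E S H r.
  case: hyp => [c5|[W WE [nP nT7 nT12]]]; first exact: state_circumference.
  (* This vertex only serves as the default value of [nth]. *)
  have [x _] := imsetP WE.
  move=> _; apply: (state_limb x cactusE WE) => ps.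
  rewrite !inE => /or4P[/eqP->|/eqP->|/eqP->|].
  - exact: (nP 1).
  - exact: (nP 2).
  - exact: (nP 3).
  case/or4P=> [/eqP->|/eqP->|/eqP->|/orP[]/eqP->] //.
  - exact: (nP 4).
  - exact: (nP 5).
  exact: (nP 6).
have [H' [r' st']] := state_full cactusE st.
have [H3 EH] := EI_state cactusE st'.
by exists (hyperedges H').
Qed.
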